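(* There is a countable topological group $\mathbb G$ and a tame, weakly closed, invariant ideal $\mathcal I\subseteq\mathcal P(\mathbb G)$ such that both of the following alternatives fail: (1) there is a countable $\mathcal S\subseteq\mathcal I$ such that for every infinite sequence $C$ convergent in $\mathbb G$ there is $I\in\mathcal S$ with $C\cap I$ infinite; (2) there is a countable $\mathcal H\subseteq\mathcal I^+$ such that for every non-empty open $U\subseteq\mathbb G$ there is $H\in\mathcal H$ with $H\setminus U\in\mathcal I$.
   Context: All topological spaces and groups are $T_1$ and completely regular. A sequence converging to $x$ is identified with an infinite set $C$ such that $C\setminus U$ is finite for every neighborhood $U$ of $x$ (written $C\to x$). $A\subseteq^* B$ means $A\setminus B$ is finite. An ideal on a set $X$ is a family of subsets of $X$ closed under subsets and finite unions; all ideals are assumed to contain all finite sets. $\mathcal I^+=\mathcal P(X)\setminus\mathcal I$. An ideal $\mathcal I$ on a group $\mathbb G$ is invariant if $g\cdot I$, $I\cdot g$ and $I^{-1}$ are in $\mathcal I$ for all $I\in\mathcal I$, $g\in\mathbb G$. An ideal $\mathcal I$ on $X$ is $\omega$-hitting if for every countable family $\mathcal Y$ of infinite subsets of $X$ there is $I\in\mathcal I$ with $Y\cap I$ infinite for every $Y\in\mathcal Y$. An ideal $\mathcal I$ is tame if for every $Y\in\mathcal I^+$, every $f:Y\to\omega$ and every $\omega$-hitting ideal $\mathcal J$ on $\omega$ there is $J\in\mathcal J$ with $f^{-1}[J]\notin\mathcal I$. An ideal $\mathcal I$ on a topological group $\mathbb G$ is weakly closed if for every $A\subseteq\mathbb G$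 and every (infinite) sequence $C\subseteq\mathbb G$ converging to $1_{\mathbb G}$: $A\in\mathcal I$ if and only if $A\cup\{x: C\cdot x\subseteq^* A\}\in\mathcal I$. *)

(* Defs.v *)
From HB Require Import structures.
From mathcomp Require Import all_boot.
From mathcomp Require Import all_classical.
From mathcomp Require Import topology normedtype.

Set Implicit Arguments.
Unset Strict Implicit.
Unset Printing Implicit Defensive.

Local Open Scope classical_set_scope.
Local Open Scope group_scope.

HB.mixin Record isTopologicalGroup G & Topological G & Group G := {
  mulg_continuous : continuous (fun x : G * G => x.1 * x.2) ;
  invg_continuous : continuous (fun x : G => x^-1)
}.

#[short(type="topologicalGroupType")]
HB.structure Definition TopologicalGroup :=
  {G of Topological G & Group G & isTopologicalGroup G}.

Definition almost_subset (X : Type) (A B : set X) : Prop :=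
  finite_set (A `\` B).

(* A convergent sequence is identified with its range, an infinite set. *)
Definition converges_to (T : topologicalType) (C : set T) (x : T) : Prop :=
  infinite_set C /\ forall U, nbhs x U -> almost_subset C U.

(* Ideals need not be proper; they contain all finite sets. *)
Record is_ideal (X : Type) (I : set_system X) : Prop := IsIdeal {
  ideal_subset : forall A B, A `<=` B -> I B -> I A ;
  ideal_setU : forall A B, I A -> I B -> I (A `|` B) ;
  ideal_finite : forall A, finite_set A -> I A
}.

Definition positive_sets (X : Type) (I : set_system X) : set_system X := ~` I.

Definition invariant_ideal (G : groupType) (I : set_system G) : Prop :=
  forall A g, I A ->
    [/\ I [set g * x | x in A], I [set x * g | x in A] &
        I [set x^-1 | x in A]].

Definition omega_hitting (X : Type) (I : set_system X) : Prop :=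
  forall F : set_system X, countable F ->
    (forall Y, F Y -> infinite_set Y) ->
    exists2 A, I A & forall Y, F Y -> infinite_set (Y `&` A).

(* A function Y -> nat is represented by any extension f : X -> nat of it;
   the preimage of J under it is Y `&` f @^-1` J. *)
Definition tame (X : Type) (I : set_system X) : Prop :=
  forall (Y : set X) (f : X -> nat) (J : set_system nat),
    positive_sets I Y -> is_ideal J -> omega_hitting J ->
    exists2 A, J A & ~ I (Y `&` f @^-1` A).

Definition weakly_closed (G : topologicalGroupType) (I : set_system G) : Prop :=
  forall A C : set G, converges_to C 1 ->
    (I A <-> I (A `|` [set x | almost_subset [set c * x | c in C] A])).

(* Main.v *)
(* Take a <*-increasing unbounded sequence of monotone functions f_a, indexed by
   the bounding number, so that families indexed by proper initial segments are
   bounded.  Call a subset of N x N thin if its columns are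
   finite and it meets the graph of every f_a in a finite set, and let E be the
   ideal of the sets meeting every thin set in a finite set.  Then every
   countable subfamily of E is avoided by the graph of some f_a, which lies in
   E, whereas countably many sets outside E are hit, each in an infinite set, by
   a single set orthogonal to E.

   Let G be the group of finitely supported integer functions on N x N, a base
   at the identity being the subgroups of functions vanishing on D, for D
   orthogonal to E, and let I consist of the subsets of G whose members have
   their supports inside a common element of E.  Members of E, viewed as sets of
   basis vectors, converge to the identity, so the first property of E refutes
   (1); the second one refutes (2) and also gives tameness. *)
Require Import Defs.
From HB Require Import structures.
From mathcomp Require Import all_boot ssralg poly ssrint.
From mathcomp Require Import all_classical wochoice.
From mathcomp Require Import topology normedtype.

Set Implicit Arguments.
Unset Strict Implicit.
Unset Printing Implicit Defensive.

Local Open Scope classical_set_scope.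

(** * Eventual domination and unbounded scales *)

Definition eventually_le (f g : nat -> nat) : Prop :=
  exists N, forall k, N <= k -> f k <= g k.

Definition eventually_lt (f g : nat -> nat) : Prop :=
  exists N, forall k, N <= k -> f k < g k.

Definition bounded_family (T : Type) (phi : T -> nat -> nat) : Prop :=
  exists g, forall t, eventually_le (phi t) g.

Lemma eventually_le_trans f g h :
  eventually_le f g -> eventually_le g h -> eventually_le f h.
Proof.
move=> [M fg] [N gh]; exists (maxn M N) => k; rewrite geq_max => /andP[Mk Nk].
exact: leq_trans (fg k Mk) (gh k Nk).
Qed.

Lemma eventually_ltW f g : eventually_lt f g -> eventually_le f g.
Proof. by move=> [N fg]; exists N => k /fg/ltnW. Qed.

Lemma bounded_seq (phi : nat -> nat -> nat) : bounded_family phi.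
Proof.
exists (fun k => \sum_(n < k.+1) phi n k) => n; exists n => k nk.
have nk' : n < k.+1 by [].
by rewrite (bigD1 (Ordinal nk')) //= leq_addr.
Qed.

(* [W] is the initial segment of those points [a] of a well-order of
   [nat -> nat] for which families indexed by the predecessors of [a] are
   bounded; its order type is the bounding number. *)
Lemma minimal_unbounded_index :
  exists (W : Type) (lt : W -> W -> Prop) (u : W -> nat -> nat),
    [/\ well_founded lt, forall a b, [\/ a = b, lt a b | lt b a],
        forall a (phi : W -> nat -> nat),
          bounded_family (fun b : {b | lt b a} => phi (sval b)) &
        ~ bounded_family u].
Proof.
pose T := nat -> nat.
have [R woR] := well_ordering_principle T.
pose lt (b a : T) := R b a /\ b <> a.
have minP (P : set T) : P !=set0 ->
    exists2 z, P z & forall x, P x -> x = z \/ lt z x.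
  move=> [x Px]; have [|z [[Pz zmin] _]] := woR (fun x => `[< P x >]).
    by exists x; apply/asboolP.
  exists z; first exact/asboolP.
  move=> y /asboolP Py; have [<-|yz] := pselect (y = z); first by left.
  by right; split; [exact: zmin|exact/nesym].
have Rch : chain R predT by apply: wo_chainW => A _; exact: woR.
have Ranti : antisymmetric R.
  have := @wo_chain_antisymmetric T R predT (fun A _ => woR A).
  by move=> Ra x y; apply: Ra.
have lt_total a b : [\/ a = b, lt a b | lt b a].
  have [->|ab] := pselect (a = b); first exact: Or31.
  have /orP[Rab|Rba] := Rch a b isT isT; first exact: Or32.
  by apply: Or33; split => //; exact/nesym.
have lt_asym a b : lt a b -> lt b a -> False.
  by move=> [ab nab] [ba _]; apply: nab; apply: Ranti; rewrite ab ba.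
have lt_wf : well_founded lt.
  move=> a; apply: contrapT => na.
  have [|z nz zmin] := minP [set x | ~ Acc lt x]; first by exists a.
  apply: nz; constructor => y yz; apply: contrapT => ny.
  by case: (zmin y ny) => [yz'|/lt_asym]; [case: yz|exact].
pose good a := forall phi : T -> nat -> nat,
  bounded_family (fun b : {b | lt b a} => phi (sval b)).
pose W := {a | good a}.
have restr (phi : W -> nat -> nat) :
  exists psi : T -> nat -> nat, forall b : W, psi (sval b) = phi b.
  exists (fun b => if pselect (good b) is left gb then phi (exist _ b gb)
                   else fun=> 0) => -[b gb] /=.
  by case: pselect => // gb'; congr (phi (exist _ _ _)).
have [u nu] : exists u : W -> nat -> nat, ~ bounded_family u.
  apply/existsNP => bndW.
  (* By [bndW] a least bad point would be good; with all points good, one function would dominate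
     every function. *)
  have good_all a : good a.
    apply: contrapT => na; have [b nb bmin] := minP (~` good) (ex_intro _ a na).
    apply: nb => phi; have [g gP] := bndW (phi \o sval).
    exists g => -[c [Rcb ncb]] /=.
    have gc : good c.
      apply: contrapT => /bmin[//|/lt_asym]; apply; exact: (conj Rcb ncb).
    exact: (gP (exist _ c gc)).
  have [g gP] := bndW sval.
  have [N] := gP (exist _ (fun k => (g k).+1) (good_all _)).
  by move=> /(_ N (leqnn N)) /=; rewrite ltnn.
exists W, (fun a b => lt (sval a) (sval b)), u; split; last exact: nu.
- move=> [a ga]; elim/(well_founded_induction lt_wf): a ga => a IH ga.
  by constructor => -[b gb] ba; apply: IH.
- move=> [a ga] [b gb] /=; case: (lt_total a b) => [ab|ab|ab].
  + by apply: Or31; subst b; congr exist.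
  + exact: Or32.
  + exact: Or33.
- move=> [a ga] phi; have [psi psiE] := restr phi.
  have [g gP] := ga psi; exists g => -[b /= ba].
  by have := gP (exist _ (sval b) ba); rewrite /= psiE.
Qed.

Definition is_scale (W : Type) (lt : W -> W -> Prop) (f : W -> nat -> nat) :=
  [/\ forall a b, [\/ a = b, lt a b | lt b a],
      forall a (phi : W -> nat -> nat),
        bounded_family (fun b : {b | lt b a} => phi (sval b)),
      forall a, {homo f a : m n / m <= n},
      forall a b, lt a b -> eventually_lt (f a) (f b) &
      ~ bounded_family f].

(** By recursion [f a] is put above [u a] and all earlier [f b], which is possible as the
    predecessors of [a] index bounded families. *)
Lemma unbounded_scale :
  exists (W : Type) (lt : W -> W -> Prop) (f : W -> nat -> nat), is_scale lt f.
Proof.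
have [W [lt [u [wf tot bnd nbnd]]]] := minimal_unbounded_index.
have step (a : W) (r : forall b, lt b a -> nat -> nat) : exists g : nat -> nat,
    [/\ {homo g : m n / m <= n}, forall b (ba : lt b a), eventually_lt (r b ba) g
      & eventually_le (u a) g].
  have [g gP] := bnd a (fun b => if pselect (lt b a) is left ba then r b ba
                                 else fun=> 0).
  (* Summing up to [k] ensures monotonicity; the successor makes the domination strict. *)
  exists (fun k => \sum_(j < k.+1) (g j + u a j).+1); split.
  - move=> m n mn; rewrite (big_ord_widen_cond n.+1 xpredT (fun j => (g j + u a j).+1)) //.
    by rewrite [leqRHS](bigID (fun j : 'I_n.+1 => j < m.+1)) /= leq_addr.
  - move=> b ba; have [N] := gP (exist _ b ba) => /= rg; exists N => k /rg.
    case: pselect => // ba'; rewrite (Prop_irrelevance ba' ba) => rgk.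
    by rewrite big_ord_recr /= addnS ltnS addnCA (leq_trans rgk) ?leq_addr.
  - by exists 0 => k _; rewrite big_ord_recr /= addnS leqW // addnA leq_addl.
pose F (a : W) r := sval (cid (@step a r)).
exists W, lt, (Fix wf _ F).
have FE a : Fix wf _ F a = F a (fun b _ => Fix wf _ F b).
  apply: Fix_eq => b r s rs; congr F.
  by apply: functional_extensionality_dep => c; apply: funext.
split => //.
- by move=> a; rewrite FE /F; case: cid => g [].
- by move=> a b ab; rewrite [in X in _ _ X]FE /F; case: cid => g [/= _ /(_ _ ab)].
- move=> [g gP]; apply: nbnd; exists g => a; apply: eventually_le_trans (gP a).
  by rewrite FE /F; case: cid => ? [].
Qed.

(** Without a strict upper bound the sequence would be cofinal, and a bound of its countably many
    functions would bound [f]. *)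
Lemma scale_sup W lt f (a : nat -> W) :
  is_scale lt f -> exists b, forall n, lt (a n) b.
Proof.
move=> [tot _ _ incr unb]; apply: contrapT => /forallNP nob; apply: unb.
have [g gP] := bounded_seq (f \o a); exists g => b.
have /existsNP[n nlt] := nob b; apply: eventually_le_trans (gP n) => /=.
by case: (tot (a n) b) => [->|//|/incr/eventually_ltW //]; exists 0.
Qed.

Lemma scale_escape W lt f (M : nat -> set nat) (h : nat -> nat) :
  is_scale lt f -> (forall n N, exists2 k, M n k & N <= k) ->
  exists a : W, forall n N, exists k, [/\ M n k, N <= k & h k < f a k].
Proof.
move=> scale unbM; have [tot _ mono incr unb] := scale.
have /choice[a aP] n : exists a, forall N, exists k,
    [/\ M n k, N <= k & h k < f a k].
  apply: contrapT => /forallNP noa; apply: unb.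
  have /choice[next nextP] N : exists k, M n k /\ N <= k.
    by have [k] := unbM n N; exists k.
  (* By monotonicity [f b k <= f b (next k) <= h (next k)] for large [k]. *)
  exists (h \o next) => b; have /existsNP[N NP] := noa b.
  exists N => k Nk /=; have [Mk kn] := nextP k.
  apply: (leq_trans (mono b _ _ kn)); rewrite leqNgt; apply/negP => lthf.
  by apply: NP; exists (next k); split => //; exact: leq_trans kn.
have [b bP] := scale_sup a scale; exists b => n N.
have [N' N'P] := incr _ _ (bP n).
have [k [Mk]] := aP n (maxn N N'); rewrite geq_max => /andP[Nk N'k] hk.
by exists k; split => //; exact: ltn_trans (N'P _ N'k).
Qed.

(** * Thin sets and selectors *)

Definition below (h : nat -> nat) (D : set (nat * nat)) : Prop :=
  forall p, D p -> p.2 <= h p.1.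

(** A graph has one point per column, so this means that it meets [D] in a finite set. *)
Definition bounded_meet (D : set (nat * nat)) (f : nat -> nat) : Prop :=
  exists N, forall p, D p -> p.2 = f p.1 -> p.1 < N.

Definition thin (W : Type) (f : W -> nat -> nat) : set_system (nat * nat) :=
  [set D | (exists h, below h D) /\ forall a, bounded_meet D (f a)].

Lemma below_finite h D N : below h D -> (forall p, D p -> p.1 < N) -> finite_set D.
Proof.
move=> hD DN; apply: (@sub_finite_set _ _ (`I_N `*`` (fun k => `I_(h k).+1))).
  by move=> p Dp; split => /=; [exact: DN|rewrite ltnS; exact: hD].
by apply: finite_setXR => [|k _]; exact: finite_II.
Qed.

Lemma below_infinite h D N :
  below h D -> infinite_set D -> exists2 p, D p & N <= p.1.
Proof.
move=> hD infD; apply: contrapT => noP; apply: infD.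
apply: (below_finite hD (N := N)) => p Dp; rewrite ltnNge; apply/negP => Np.
by apply: noP; exists p.
Qed.

Lemma unbounded_infinite (D : set (nat * nat)) :
  (forall N, exists2 p, D p & N <= p.1) -> infinite_set D.
Proof.
move=> unbD finD; have /finite_seqP[F FE] : finite_set (fst @` D).
  exact: finite_image.
have [p Dp] := unbD (\sum_(k <- F) k).+1; rewrite ltnNge => /negP; apply.
have pF : p.1 \in F by have : [set` F] p.1 by rewrite -FE; exists p.
by rewrite (big_rem _ pF) /= leq_addr.
Qed.

(* If [a] escapes a bound [h] of all the [P i], then where [h < f a] only the graphs of
   [f b] with [b] before [a] matter, and families indexed by such [b] are
   bounded. *)
Lemma thin_selector W lt f (P : nat -> set (nat * nat)) (t : nat -> nat) :
  @is_scale W lt f ->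
  (forall i, exists h, below h (P i)) ->
  (forall i N, exists2 p, P i p & N <= p.1) ->
  (forall b, exists N, forall i, N <= i -> bounded_meet (P i) (f b)) ->
  exists2 D, thin f D & forall i, exists p, [/\ D p, P i p & t i <= p.1].
Proof.
move=> scale /choice[hP hPP] unbP meetP; have [tot bnd mono incr unb] := scale.
have [h hPh] := bounded_seq hP.
have [a aP] : exists a, forall i N, exists k,
    [/\ (fst @` P i) k, N <= k & h k < f a k].
  apply: (scale_escape _ scale) => i N.
  by have [p Pp Np] := unbP i N; exists p.1 => //; exists p.
(* [phi b i] bounds the columns where [P i] meets the graph of [f b]; for each [b] the default 0
   occurs for finitely many [i] only. *)
pose phi b i := if pselect (bounded_meet (P i) (f b)) is left bm
                then sval (cid bm) else 0.
have [g gP] := bnd a phi.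
have /choice[q qP] i : exists p, [/\ P i p, maxn (g i) (t i) <= p.1,
    p.2 <= h p.1 & h p.1 < f a p.1].
  have [N NP] := hPh i.
  have [k [[p Pp <-]]] := aP i (maxn N (maxn (g i) (t i))).
  rewrite geq_max => /andP[Np gtp] hp; exists p; split => //.
  by apply: leq_trans (NP _ Np); exact: hPP.
have qa i b N : (forall k, N <= k -> f a k <= f b k) -> (q i).2 = f b (q i).1 ->
    (q i).1 < N.
  move=> ab qb; rewrite ltnNge; apply/negP => /ab.
  have [_ _ qh hq] := qP i.
  by rewrite -qb leqNgt (leq_ltn_trans qh).
exists (range q); last first.
  move=> i; exists (q i); have [Pq] := qP i.
  by rewrite geq_max => /andP[_ tq] _ _; split.
split; first by exists h => _ [i _ <-]; have [] := qP i.
move=> b; have [ab|ab|ba] := tot a b.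
- by exists 0 => _ [i _ <-]; apply: qa; rewrite ab.
- by have [N NP] := incr _ _ ab; exists N => _ [i _ <-]; apply: qa => k /NP/ltnW.
- have [N NP] := gP (exist _ b ba); have [N' N'P] := meetP b.
  (* The sum covers the finitely many early points; later ones lie beyond [g i] and so miss the
     graph. *)
  exists (\sum_(i < maxn N N') (q i).1).+1 => _ [i _ <-] qb.
  have [iN|] := ltnP i (maxn N N').
    by rewrite ltnS (bigD1 (Ordinal iN)) //= leq_addr.
  rewrite geq_max => /andP[/NP /= + /N'P bm]; rewrite /phi.
  case: pselect => // bm'; case: cid => /= K KP Kg; have [Pq + _ _] := qP i.
  rewrite geq_max => /andP[gq _].
  by have := KP _ Pq qb; rewrite ltnNge (leq_trans Kg gq).
Qed.

(** * The ideal orthogonal to the thin sets *)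

Definition orthogonal (X : Type) (F : set_system X) : set_system X :=
  [set A | forall B, F B -> finite_set (A `&` B)].

Lemma orthogonal_ideal X (F : set_system X) : is_ideal (orthogonal F).
Proof.
split=> [A B AB oB C FC|A B oA oB C FC|A finA C _].
- by apply: sub_finite_set (oB C FC); exact: setSI.
- by rewrite setIUl finite_setU; split; [exact: oA|exact: oB].
- exact: finite_setIl.
Qed.

Lemma eventually_lt_bounded_meet f g (D : set (nat * nat)) :
  eventually_lt f g \/ eventually_lt g f ->
  bounded_meet (D `&` [set p | p.2 = f p.1]) g.
Proof.
move=> fg; have [N NP] : exists N, forall k, N <= k -> f k <> g k.
  by case: fg => -[N NP]; exists N => k /NP + E; rewrite E ltnn.
exists N => p [_ /= pf] pg; rewrite ltnNge; apply/negP => /NP; apply.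
by rewrite -pf -pg.
Qed.

(** Otherwise the graphs along an increasing sequence meet [S] in infinite sets, and a thin selector
    from these meets [S] infinitely often. *)
Lemma orthogonal_thin_meet W lt f (S : set (nat * nat)) :
  @is_scale W lt f -> orthogonal (thin f) S ->
  exists b, forall c, lt b c -> bounded_meet S (f c).
Proof.
move=> scale oS; have [tot bnd mono incr unb] := scale.
apply: contrapT => /forallNP nob.
have /choice[next nextP] b : exists c, lt b c /\ ~ bounded_meet S (f c).
  by have /existsNP[c /not_implyP] := nob b; exists c.
have [b0 _] : exists b : W, True.
  apply: contrapT => /forallNP noW; apply: unb; exists id => b.
  by case: (noW b).
(* Starting at [next b0] makes already the first graph meet [S] unboundedly. *)
pose a i := iter i next (next b0).
have a_incr i j : i < j -> eventually_lt (f (a i)) (f (a j)).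
  elim: j => // j IHj; rewrite ltnS leq_eqVlt => /orP[/eqP->|/IHj [N NP]].
    by apply: incr; have [] := nextP (a j).
  have [N' N'P] := incr _ _ (nextP (a j)).1; exists (maxn N N') => k.
  rewrite geq_max => /andP[/NP ij /N'P]; exact: ltn_trans.
have a_meet i : ~ bounded_meet S (f (a i)).
  by rewrite /a; case: i => [|i] /=; exact: (nextP _).2.
have [i|i N|b|D Dthin DP] := thin_selector
    (P := fun i => S `&` [set p | p.2 = f (a i) p.1]) id scale.
- by exists (f (a i)) => p [_ /= ->].
- apply: contrapT => noP; apply: (a_meet i); exists N => p Sp pE.
  by rewrite ltnNge; apply/negP => Np; apply: noP; exists p.
- have [[j bE]|nb] := pselect (exists j, b = a j).
    by exists j.+1 => i ji; apply: eventually_lt_bounded_meet; right; rewrite bE;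
      exact: a_incr.
  exists 0 => i _; apply: eventually_lt_bounded_meet.
  have [ab|/incr ab|/incr ba] := tot (a i) b; [|by left|by right].
  by case: nb; exists i.
have: infinite_set (S `&` D).
  by apply: unbounded_infinite => N; have [p [Dp [Sp _] Np]] := DP N; exists p.
by apply; exact: oS.
Qed.

(* In the space with one non-isolated point whose neighbourhoods have complement
   in [E], the sequences converging to that point are the infinite members of
   [orthogonal E]; the last clause says that this space is Fréchet and
   [alpha_2]. *)
Lemma exists_hitting_ideal : exists E : set_system (nat * nat),
  [/\ is_ideal E,
      forall S : nat -> set (nat * nat), (forall n, E (S n)) ->
        exists K, [/\ infinite_set K, E K & forall n, finite_set (K `&` S n)] &
      forall P : nat -> set (nat * nat), (forall n, ~ E (P n)) ->
        exists2 D, orthogonal E D & forall n, infinite_set (P n `&` D)].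
Proof.
have [W [lt [f scale]]] := unbounded_scale; exists (orthogonal (thin f)).
have [tot bnd mono incr unb] := scale.
split; first exact: orthogonal_ideal.
- move=> S oS.
  have /choice[b bP] n := orthogonal_thin_meet scale (oS n).
  have [c cP] := scale_sup b scale.
  have gc : below (f c) [set p | p.2 = f c p.1] by move=> p /= ->.
  have gm (D : set (nat * nat)) : bounded_meet D (f c) ->
      finite_set ([set p | p.2 = f c p.1] `&` D).
    move=> [N NP]; apply: (@below_finite (f c) _ N) => p [/= pc Dp]; last exact: NP.
    by rewrite pc.
  exists [set p | p.2 = f c p.1]; split.
  + by apply: unbounded_infinite => N; exists (N, f c N).
  + by move=> D [_ /(_ c)]; exact: gm.
  + by move=> n; apply: gm; exact: bP (cP n).
- move=> P nP.
  have /choice[Q QP] n : exists Q, thin f Q /\ infinite_set (P n `&` Q).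
    by have /existsNP[Q /not_implyP] := nP n; exists Q.
  (* [u] runs through all pairs [(n, N)], so one selector meets every [P n] in arbitrarily late
     columns. *)
  pose u i : nat * nat := odflt (0, 0) (unpickle i).
  have [i|i N|b|D Dthin DP] := thin_selector
      (P := fun i => P (u i).1 `&` Q (u i).1) (fun i => (u i).2) scale.
  + by have [[[h hQ] _] _] := QP (u i).1; exists h => p [_]; exact: hQ.
  + have [[[h hQ] _] infQ] := QP (u i).1.
    by apply: (@below_infinite h) infQ => p [_]; exact: hQ.
  + exists 0 => i _; have [[_ /(_ b)[N NP]] _] := QP (u i).1.
    by exists N => p [_]; exact: NP.
  exists D; first by move=> S oS; rewrite setIC; exact: oS.
  move=> n; apply: unbounded_infinite => N.
  have [p] := DP (pickle (n, N)); rewrite /u pickleK /= => -[Dp [Pp _] Np].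
  by exists p.
Qed.

(** * The countable group and its topology *)

Definition finsupp (E : set_system (nat * nat)) : Type := {poly {poly int}}.

HB.instance Definition _ E := Choice.on (finsupp E).

(** The coefficients of a polynomial in two variables are the values of a finitely supported
    function; the tag [E] on the type selects the topology. *)
Definition coord E (g : finsupp E) (p : nat * nat) : int := (g`_p.1`_p.2)%R.

Definition agree E (D : set (nat * nat)) (g h : finsupp E) : Prop :=
  forall p, D p -> coord g p = coord h p.

(** Defining the topology by a uniformity also yields complete regularity. *)
Definition finsupp_entourage E : set_system (finsupp E * finsupp E) :=
  [set A | exists2 D, orthogonal E D & forall g h, agree D g h -> A (g, h)].

Lemma finsupp_entourage_filter E : Filter (@finsupp_entourage E).
Proof.
have [sub cup fin] := orthogonal_ideal E; split.
- by exists set0 => //; exact: fin.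
- move=> A B [D oD DA] [D' oD' DB]; exists (D `|` D'); first exact: cup.
  by move=> g h gh; split; [apply: DA|apply: DB] => p Dp; apply: gh; [left|right].
- by move=> A B AB [D oD DA]; exists D => // g h /DA /AB.
Qed.

Lemma finsupp_entourage_diagonal E A :
  @finsupp_entourage E A -> diagonal `<=` A.
Proof. by move=> [D oD DA] [g h] gh; apply: DA; rewrite -[g]/((g, h).1) gh. Qed.

Lemma finsupp_entourage_inv E A :
  @finsupp_entourage E A -> finsupp_entourage (A^-1)%relation.
Proof.
move=> [D oD DA]; exists D => // g h gh; apply: DA => p Dp.
by rewrite gh.
Qed.

Lemma finsupp_entourage_split E A :
  @finsupp_entourage E A -> exists2 B, @finsupp_entourage E B &
    (B \; B `<=` A)%relation.
Proof.
move=> [D oD DA]; exists [set gh | agree D gh.1 gh.2]; first by exists D.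
by move=> [g h] /= [k gk kh]; apply: DA => p Dp; rewrite gk // kh.
Qed.

HB.instance Definition _ E := isUniform.Build (finsupp E)
  (@finsupp_entourage_filter E) (@finsupp_entourage_diagonal E)
  (@finsupp_entourage_inv E) (@finsupp_entourage_split E).

Definition finsupp_zero E : finsupp E := 0%R : {poly {poly int}}.
Definition finsupp_add E (g h : finsupp E) : finsupp E :=
  (g + h)%R : {poly {poly int}}.
Definition finsupp_opp E (g : finsupp E) : finsupp E :=
  (- g)%R : {poly {poly int}}.

HB.instance Definition _ E := isGroup.Build (finsupp E)
  (@GRing.addrA {poly {poly int}} : associative (@finsupp_add E))
  (@GRing.add0r {poly {poly int}} : left_id (@finsupp_zero E) _)
  (@GRing.addr0 {poly {poly int}} : right_id (@finsupp_zero E) _)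
  (@GRing.addNr {poly {poly int}} : left_inverse _ (@finsupp_opp E) _)
  (@GRing.addrN {poly {poly int}} : right_inverse _ (@finsupp_opp E) _).

Section Coordinates.
Context {E : set_system (nat * nat)}.
Implicit Types g h : finsupp E.
Local Open Scope group_scope.

Lemma coord1 p : coord (1 : finsupp E) p = 0%R.
Proof. by rewrite /coord !coef0. Qed.

Lemma coordM g h p : coord (g * h) p = (coord g p + coord h p)%R.
Proof. by rewrite /coord !coefD. Qed.

Lemma coordV g p : coord g^-1 p = (- coord g p)%R.
Proof. by rewrite /coord !coefN. Qed.

Lemma coord_inj g h : (forall p, coord g p = coord h p) -> g = h.
Proof. by move=> gh; apply/polyP => i; apply/polyP => j; exact: (gh (i, j)). Qed.

Lemma finite_coord g : finite_set [set p | coord g p != 0%R].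
Proof.
apply: (@sub_finite_set _ _ (`I_(size g) `*`` (fun i => `I_(size g`_i)%R))).
  move=> [i j]; rewrite /coord /= => gij; split => /=; rewrite ltnNge;
    apply: contra gij => le; last by rewrite nth_default.
  by rewrite (nth_default _ le) coef0.
by apply: finite_setXR => [|k _]; exact: finite_II.
Qed.

Lemma nbhs_finsuppP g (U : set (finsupp E)) :
  nbhs g U <-> exists2 D, orthogonal E D & forall h, agree D g h -> U h.
Proof.
rewrite -nbhs_entourageE; split=> [[A [D oD DA] AU]|[D oD DU]].
  by exists D => // h /DA gh; apply: AU; apply/xsectionP.
exists [set gh | agree D gh.1 gh.2]; first by exists D.
by move=> h /xsectionP/DU.
Qed.

End Coordinates.

Section Topology.
Variable E : set_system (nat * nat).
Local Open Scope group_scope.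

Lemma finsupp_mul_continuous :
  continuous (fun x : finsupp E * finsupp E => x.1 * x.2).
Proof.
move=> [g h] U /= /nbhs_finsuppP[D oD DU].
exists ([set k | agree D g k], [set k | agree D h k]).
  by split; apply/nbhs_finsuppP; exists D.
move=> [g' h'] /= [gg' hh']; apply: DU => p Dp.
by rewrite !coordM gg' ?hh'.
Qed.

Lemma finsupp_inv_continuous : continuous (fun g : finsupp E => g^-1).
Proof.
move=> g U /= /nbhs_finsuppP[D oD DU]; apply/nbhs_finsuppP; exists D => // h gh.
by apply: DU => p Dp; rewrite !coordV gh.
Qed.

End Topology.

HB.instance Definition _ E := isTopologicalGroup.Build (finsupp E)
  (@finsupp_mul_continuous E) (@finsupp_inv_continuous E).

(* The library's [uniform_completely_regular] takes a [realType] that its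
   conclusion does not mention. *)
Lemma uniform_point_separation (T : uniformType) : completely_regular_space T.
Proof.
move=> x B; rewrite -openC openE => /[swap] nBx /(_ x nBx).
rewrite /interior -nbhs_entourageE => -[A entA AB].
exists (Uniform.class T), A; split; [exact: entA| |by move=> ? ?].
apply/seteqP; split=> // -[_ y] [[/= -> By] /xsectionP/AB]; exact.
Qed.

(** * The ideal of sets with small support *)

Section SupportIdeal.
Variable E : set_system (nat * nat).
Implicit Types (g h : finsupp E) (A B : set (finsupp E)).

(** Singletons are orthogonal to [E], so every coordinate is locally constant. *)
Lemma finsupp_accessible : accessible_space (finsupp E).
Proof.
move=> g h gh; have [p ghp] : exists p, coord g p != coord h p.
  apply: contrapT => /forallNP same; move/eqP: gh; apply; apply: coord_inj => p.
  by apply/eqP; rewrite -[_ == _]negbK; apply/negP => /same.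
have [_ _ fin] := orthogonal_ideal E.
exists [set k | coord k p = coord g p]; split; last 2 first.
- by rewrite inE.
- by rewrite in_setE /=; apply: nesym; exact/eqP.
rewrite openE => k /= kp; apply/nbhs_finsuppP; exists [set p]; first exact: fin.
by move=> k' kk' /=; rewrite -kk'.
Qed.

Definition support A : set (nat * nat) :=
  \bigcup_(g in A) [set p | coord g p != 0%R].

Definition support_ideal : set_system (finsupp E) := [set A | E (support A)].

Local Open Scope group_scope.

Definition basis_vector (p : nat * nat) : finsupp E :=
  (('X^(p.2))%:P * 'X^(p.1))%R : {poly {poly int}}.

Lemma coord_basis_vector p q : coord (basis_vector p) q = ((q == p)%:R)%R.
Proof.
rewrite /coord /basis_vector coefMXn coefC; case: p q => [i j] [k l] /=.
rewrite xpair_eqE subn_eq0; case: ltngtP => ki /=; rewrite ?coef0 ?coefXn //.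
Qed.

Lemma basis_vector_inj : injective basis_vector.
Proof.
move=> p q pq; have := coord_basis_vector p q.
by rewrite pq coord_basis_vector eqxx; case: eqP => // ->.
Qed.

Hypothesis idE : is_ideal E.

Lemma support_ideal_ideal : is_ideal support_ideal.
Proof.
have [sub cup fin] := idE; split.
- by move=> A B AB; apply: sub; exact: bigcup_subset.
- by move=> A B EA EB; rewrite /support_ideal /= /support bigcup_setU; exact: cup.
- by move=> A finA; apply: fin; apply: bigcup_finite => // g _; exact: finite_coord.
Qed.

Lemma support_ideal_invariant : invariant_ideal support_ideal.
Proof.
have [sub cup fin] := idE; move=> A g EA; split.
- apply: sub (cup _ _ (fin _ (finite_coord g)) EA).
  move=> p [_ [h Ah <-]] /=; rewrite coordM => ghp.
  have [hp|hp] := eqVneq (coord h p) 0%R; last by right; exists h.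
  by left; move: ghp; rewrite /= hp GRing.addr0.
- apply: sub (cup _ _ (fin _ (finite_coord g)) EA).
  move=> p [_ [h Ah <-]] /=; rewrite coordM => ghp.
  have [hp|hp] := eqVneq (coord h p) 0%R; last by right; exists h.
  by left; move: ghp; rewrite /= hp GRing.add0r.
- apply: sub EA => p [_ [h Ah <-]] /=; rewrite coordV GRing.oppr_eq0 => hp.
  by exists h.
Qed.

(* If [C x] is almost contained in [A] then [x] is supported in the support of
   [A]: outside it, almost all elements of [C] would share the nonzero
   coordinate [- x p], which is impossible as [C] converges to [1]. *)
Lemma support_ideal_weakly_closed : weakly_closed support_ideal.
Proof.
have [sub cup fin] := idE; have [_ _ finp] := orthogonal_ideal E.
move=> A C [infC cvgC]; split; last by apply: sub; apply: bigcup_subset; left.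
apply: sub => p [x [Ax|/= CxA] /= xp]; first by exists x.
apply: contrapT => npA; apply: infC.
have U1 : nbhs (1 : finsupp E) [set g | coord g p = 0%R].
  apply/nbhs_finsuppP; exists [set p]; first exact: finp.
  by move=> g /(_ p erefl); rewrite coord1.
have finC' : finite_set [set c | C c /\ ~ A (c * x)].
  apply: sub_finite_set (finite_image (fun g => g * x^-1) CxA) => c [Cc nAcx].
  exists (c * x); last by rewrite -mulgA mulgV mulg1.
  by split => //; exists c.
have fin2 : finite_set ((C `\` [set g | coord g p = 0%R]) `|`
    [set c | C c /\ ~ A (c * x)]).
  by rewrite finite_setU; split => //; exact: cvgC.
apply: sub_finite_set fin2 => c Cc.
have [cp|cp] := pselect (coord c p = 0%R); last by left.
right; split => // Acx; apply: npA; exists (c * x) => //=.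
by rewrite coordM cp GRing.add0r.
Qed.

(** The neighbourhood given by [D] omits only vectors indexed by points of [K] in [D], and these are
    finitely many. *)
Lemma cvg_basis_vector K :
  infinite_set K -> E K -> converges_to (basis_vector @` K) 1.
Proof.
move=> infK EK; split.
  move=> finK; apply: infK.
  apply: (sub_finite_set _ (finite_preimage (in2W basis_vector_inj) finK)).
  by move=> p Kp; exists p.
move=> U /nbhs_finsuppP[D oD DU].
apply: sub_finite_set (finite_image basis_vector (oD K EK)) => _ [[p Kp <-] nU].
exists p => //; split => //; apply: contrapT => nDp; apply: nU; apply: DU => q Dq.
by rewrite coord1 coord_basis_vector; case: eqP Dq => // ->.
Qed.

Hypothesis hitting : forall P : nat -> set (nat * nat), (forall n, ~ E (P n)) ->
  exists2 D, orthogonal E D & forall n, infinite_set (P n `&` D).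

Lemma support_ideal_tame : tame support_ideal.
Proof.
move=> Y f J posY [_ _ finJ] hitJ.
have [D oD /(_ 0) infYD] := hitting (fun _ : nat => posY).
have /choice[w wP] p : exists g, support Y p -> Y g /\ coord g p != 0%R.
  have [[g Yg gp]|nYp] := pselect (support Y p); first by exists g.
  by exists 1.
pose S := support Y `&` D.
(* These points lie in [D] and in the support of the preimage of [A]; being infinitely many, they
   keep it outside [E]. *)
suff [A JA infA] : exists2 A, J A & infinite_set (S `&` [set p | A (f (w p))]).
  exists A => // EA; apply: infA; apply: sub_finite_set (oD _ EA).
  move=> p [[Yp Dp] /= Afp]; split => //; have [Ywp wpp] := wP p Yp.
  by exists (w p).
(* A finite set of values belongs to [J] itself; an infinite one is hit by a member of [J]. *)
have [finS|infS] := pselect (finite_set ((f \o w) @` S)).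
  exists ((f \o w) @` S); first exact: finJ.
  by apply: sub_infinite_set infYD => p Sp; split => //; exists p.
have [_ ->//|A JA /(_ _ erefl) AP] := hitJ [set (f \o w) @` S] (countable1 _).
exists A => // finA; apply: AP.
apply: sub_finite_set (finite_image (f \o w) finA) => _ [[p Sp <-] Afp].
by exists p.
Qed.

End SupportIdeal.

(** * Failure of both alternatives *)

Lemma countable_enum (T : Type) (F : set T) (x0 : T) :
  countable F -> exists s : nat -> T, F `<=` range s /\ forall n, F (s n) \/ s n = x0.
Proof.
move=> /pfcard_geP[->|[s]].
  by exists (fun=> x0); split => // n; right.
exists s; split=> [x /(@surj _ _ _ _ s)[n _ <-]|n]; first by exists n.
by left; exact: funS.
Qed.

Theorem proposition9 :
  exists (G : topologicalGroupType) (I : set_system G),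
    [/\ accessible_space G, completely_regular_space G & countable [set: G]] /\
    [/\ is_ideal I, tame I, weakly_closed I & invariant_ideal I] /\
    ~ (exists S : set_system G,
         [/\ countable S, S `<=` I &
             forall (C : set G) (x : G), converges_to C x ->
               exists2 A, S A & infinite_set (C `&` A)]) /\
    ~ (exists H : set_system G,
         [/\ countable H, H `<=` positive_sets I &
             forall U : set G, open U -> U !=set0 ->
               exists2 A, H A & I (A `\` U)]).
Proof.
have [E [idE unhit hitting]] := exists_hitting_ideal.
exists (finsupp E), (@support_ideal E).
have idI := support_ideal_ideal idE.
split; [split|split; [split|split]].
- exact: finsupp_accessible.
- exact: uniform_point_separation.
- exact: (@countableP {poly {poly int}}).
- exact: idI.
- exact: support_ideal_tame.
- exact: support_ideal_weakly_closed.
- exact: support_ideal_invariant.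
- move=> [S [cntS SI hitS]].
  have [s [Ss sS]] := countable_enum set0 cntS.
  have sI n : @support_ideal E (s n).
    by have [/SI|->] := sS n; last exact: (ideal_finite idI).
  (* The basis vectors over [K] converge to the identity and meet each [s n] in a finite set. *)
  have [K [infK EK Ks]] := unhit _ sI.
  have [A /Ss[n _ <-]] := hitS _ _ (cvg_basis_vector infK EK); apply.
  apply: sub_finite_set (finite_image (@basis_vector E) (Ks n)) => _ [[p Kp <-] sp].
  exists p => //; split => //; exists (basis_vector E p) => //=.
  by rewrite coord_basis_vector eqxx.
- move=> [H [cntH HI hitH]].
  have [s [Hs sH]] := countable_enum setT cntH.
  have sI n : ~ @support_ideal E (s n).
    (* The filler [setT] is positive too: its support is everything, so no infinite [K] almost
       avoids it. *)
    have [/HI//|-> EsT] := sH n.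
    have [K [infK _ /(_ 0) finK]] := unhit (fun=> _) (fun=> EsT); apply: infK.
    apply: sub_finite_set finK => p Kp; split => //.
    by exists (basis_vector E p) => //=; rewrite coord_basis_vector eqxx.
  have [D oD infD] := hitting _ sI.
  (* Members of [s n] nonzero somewhere on [D] lie outside this subgroup, so removing it keeps the
     infinite part of the support in [D]. *)
  have [|| A /Hs[n _ <-] EA] := hitH [set g | agree D g 1%g].
  + rewrite openE => g gD; apply/nbhs_finsuppP; exists D => // h gh p Dp.
    by rewrite -gh // gD.
  + by exists 1%g.
  apply: (infD n); apply: sub_finite_set (oD _ EA) => p [[g sg gp] Dp]; split => //.
  exists g => //; split => // /(_ p Dp); rewrite coord1 => gp0.
  by move: gp; rewrite /= gp0.
Qed.
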